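(* A unitary category is precisely the same as an inner product category. That is, let $(\mathbb{X},(-)^\dagger,\iota)$ be an involutive category. Sending a unitary structure $\varphi$ on $\mathbb{X}$ to the combinator $\langle f|g\rangle := f\,\varphi_X\, g^\dagger : A\to B^\dagger$ (for $f:A\to X$, $g:B\to X$), and sending an inner product combinator $\langle -|-\rangle$ on $\mathbb{X}$ to the family $\varphi_A := \langle 1_A|1_A\rangle : A\to A^\dagger$, gives well-defined and mutually inverse assignments between the unitary structures on $\mathbb{X}$ and the inner product combinators on $\mathbb{X}$ (so that the two kinds of structure are in bijective correspondence).
   Context: Composition is written in diagrammatic order: $fg$ means first $f$, then $g$. An involutive category $(\mathbb{X},(-)^\dagger,\iota)$ is a category $\mathbb{X}$ with a functor $(-)^\dagger:\mathbb{X}^{\mathrm{op}}\to\mathbb{X}$ and a natural isomorphism $\iota_X:X\to X^{\dagger\dagger}$ such that $\iota_{X^\dagger}(\iota_X)^\dagger=1_{X^\dagger}$ for all $X$. A unitary structure on it is a family of isomorphisms $\varphi_X:X\to X^\dagger$, one for each object $X$ (not assumed natural), such that [U.1] $\varphi_{X^\dagger}=(\varphi_X^{-1})^\dagger$ and [U.2] $\varphi_X\varphi_{X^\dagger}=\iota_X$. A unitary category is an involutive category with a unitary structure. An inner product combinator on it assigns to each pair $f:A\to X$, $g:B\to X$ a map $\langle f|g\rangle:A\to B^\dagger$ satisfying the axioms below, where for $h:X\to A$, $k:X\to B$ the dual inner product is $\langle h|k\rangle^\iota := \iota_{A^\dagger}\,\langle k^\dagger|h^\dagger\rangle^\dagger\,\iota_B^{-1}:A^\dagger\to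 B$: [IP.1] $\langle hf|kg\rangle = h\langle f|g\rangle k^\dagger$ for $f:A\to X$, $g:B\to X$, $h:Y\to A$, $k:Z\to B$; [IP.2](a) $\iota_A\langle f^\dagger|g^\dagger\rangle^\iota=\langle f|g\rangle$ and (b) $\iota_B\langle f|g\rangle^\dagger=\langle g|f\rangle$ for $f:A\to X$, $g:B\to X$; [IP.3] $\langle f|g\rangle\langle h|k\rangle^\iota = fk$ for $f:A\to X$, $g:B\to X$, $h,k:X\to B$ with $hg=1_X$; [IP.4] $\langle f|g\rangle^\iota\langle h|k\rangle=(kf)^\dagger$ for $f:A\to Z$, $g:A\to X$, $h,k:X\to A$ with $gh=1_A$. An inner product category is an involutive category with an inner product combinator. *)

(* Defs.v *)
From mathcomp Require Import ssreflect ssrfun ssrbool.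

Set Implicit Arguments.
Unset Strict Implicit.
Unset Printing Implicit Defensive.

Declare Scope cat_scope.
Delimit Scope cat_scope with cat.
Local Open Scope cat_scope.

(* Composition is diagrammatic: [f \; g] is first [f], then [g]. *)
Reserved Notation "f \; g" (at level 60, right associativity).
Reserved Notation "A ^†" (at level 1, left associativity, format "A ^†").
Reserved Notation "f ^‡" (at level 1, left associativity, format "f ^‡").

Record category := Category {
  obj :> Type;
  hom : obj -> obj -> Type;
  idm : forall A, hom A A;
  compm : forall A B D, hom A B -> hom B D -> hom A D;
  comp1m : forall A B (f : hom A B), compm (idm A) f = f;
  compm1 : forall A B (f : hom A B), compm f (idm B) = f;
  compmA : forall A B D E (f : hom A B) (g : hom B D) (h : hom D E),
    compm f (compm g h) = compm (compm f g) h
}.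

Arguments hom {c} _ _.
Arguments idm {c} A.
Arguments compm {c A B D} f g.
Notation "f \; g" := (compm f g) : cat_scope.

Definition op (C : category) : category :=
  @Category C (fun A B => @hom C B A) (@idm C)
    (fun A B D f g => compm (c := C) g f)
    (fun A B f => compm1 f) (fun A B f => comp1m f)
    (fun A B D E f g h => esym (compmA h g f)).

Record functor (C D : category) := Functor {
  fobj :> C -> D;
  fmap : forall A B, hom A B -> hom (fobj A) (fobj B);
  fmap1 : forall A, fmap (idm A) = idm (fobj A);
  fmapM : forall A B E (f : hom A B) (g : hom B E),
    fmap (f \; g) = fmap f \; fmap g
}.

Arguments fmap {C D} F {A B} f : rename.

Record iso (C : category) (A B : C) := Iso {
  iso_hom :> hom A B;
  iso_inv : hom B A;
  iso_homK : iso_hom \; iso_inv = idm A;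
  iso_invK : iso_inv \; iso_hom = idm B
}.

Definition dagger_hom (C : category) (F : functor (op C) C) (A B : C)
  (f : hom A B) : hom (F B) (F A) := @fmap (op C) C F B A f.

Record involutive_category := InvolutiveCategory {
  ic_cat :> category;
  dagger : functor (op ic_cat) ic_cat;
  iota : forall A : ic_cat, iso A (dagger (dagger A));
  iota_natural : forall (A B : ic_cat) (f : hom A B),
    f \; iota B = iota A \; dagger_hom dagger (dagger_hom dagger f);
  iota_dagger : forall A : ic_cat,
    iota (dagger A) \; dagger_hom dagger (iota A) = idm (dagger A)
}.

Arguments dagger {_}.
Arguments iota {_} A.

(* The single functor dagger, written [A ^†] on objects and [f ^‡] on maps. *)
Notation "A ^†" := (fobj dagger A) : cat_scope.
Notation "f ^‡" := (dagger_hom dagger f) : cat_scope.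

Record unitary_structure (X : involutive_category) := UnitaryStructure {
  unitary :> forall A : X, iso A (A^†);
  unitary_dagger : forall A : X,
    unitary (A^†) = (iso_inv (unitary A))^‡ :> hom (A^†) (A^†^†);
  unitary_iota : forall A : X, unitary A \; unitary (A^†) = iota A
}.

Definition combinator (X : involutive_category) :=
  forall A B Y : X, hom A Y -> hom B Y -> hom A (B^†).

Definition dual_inner (X : involutive_category) (ip : combinator X)
  (A B Y : X) (h : hom Y A) (k : hom Y B) : hom (A^†) B :=
  iota (A^†) \; (ip _ _ _ (k^‡) (h^‡))^‡ \; iso_inv (iota B).

Record inner_product (X : involutive_category) := InnerProduct {
  inner :> combinator X;
  inner_comp : forall (A B Y V W : X)
    (f : hom A Y) (g : hom B Y) (h : hom V A) (k : hom W B),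
    inner (h \; f) (k \; g) = h \; inner f g \; k^‡;
  inner_dual : forall (A B Y : X) (f : hom A Y) (g : hom B Y),
    iota A \; dual_inner inner (f^‡) (g^‡) = inner f g;
  inner_sym : forall (A B Y : X) (f : hom A Y) (g : hom B Y),
    iota B \; (inner f g)^‡ = inner g f;
  inner_mul_dual : forall (A B Y : X)
    (f : hom A Y) (g : hom B Y) (h k : hom Y B),
    h \; g = idm Y -> inner f g \; dual_inner inner h k = f \; k;
  dual_mul_inner : forall (A Y Z : X)
    (f : hom A Z) (g : hom A Y) (h k : hom Y A),
    g \; h = idm A -> dual_inner inner f g \; inner h k = (k \; f)^‡
}.

Arguments inner {X} i [A B Y] f g.

(* Main.v *)
(** The involution conjugates the combinator [f φ g†] into its dual
    [h† φ⁻¹ k]: by naturality of [ι], everything reduces to the identity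
    [ι_{A†} (φ_{A†})† ι_A⁻¹ = φ_A⁻¹], which is [U.1].  Conversely [IP.3] and
    [IP.4] at identities say that [⟨1|1⟩] is invertible with inverse
    [⟨1|1⟩^ι], and [IP.2](b) rewrites this inverse as [φ_{A†} ι_A⁻¹], which
    is [U.2].  By [IP.1], [⟨f|g⟩] is determined by [⟨1|1⟩]. *)

Require Import Defs.
From mathcomp Require Import ssreflect ssrfun ssrbool.
From Stdlib Require Import ProofIrrelevance FunctionalExtensionality.

Set Implicit Arguments.
Unset Strict Implicit.
Unset Printing Implicit Defensive.

Local Open Scope cat_scope.

Section Isomorphisms.
Variables (C : category) (A B : C).

Lemma left_inv_eq_right_inv (f : hom A B) (g h : hom B A) :
  g \; f = idm B -> f \; h = idm A -> g = h.
Proof. by move=> gf fh; rewrite -(compm1 g) -fh compmA gf comp1m. Qed.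

(** The inverse is a field of [iso] but is determined by the map; the two laws then agree by proof
    irrelevance. *)
Lemma iso_eq (f g : iso A B) : iso_hom f = iso_hom g -> f = g.
Proof.
case: f g => [f f' ff' f'f] [g g' gg' g'g] /= fg; subst g.
have fg' : f' = g' by exact: left_inv_eq_right_inv f'f gg'.
by subst g'; f_equal; exact: proof_irrelevance.
Qed.

Lemma comp_isoK (D : C) (f : hom D A) (i : iso A B) :
  (f \; i) \; iso_inv i = f.
Proof. by rewrite -compmA iso_homK compm1. Qed.

Lemma comp_isoVK (D : C) (f : hom D B) (i : iso A B) :
  (f \; iso_inv i) \; i = f.
Proof. by rewrite -compmA iso_invK compm1. Qed.

End Isomorphisms.

Section Dagger.
Variable X : involutive_category.

Lemma dagger1 (A : X) : (idm A)^‡ = idm (A^†).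
Proof. exact: (fmap1 (@dagger X)). Qed.

Lemma daggerM (A B D : X) (f : hom A B) (g : hom B D) :
  (f \; g)^‡ = g^‡ \; f^‡.
Proof. exact: (@fmapM _ _ (@dagger X) D B A g f). Qed.

Lemma iota_inv_natural (A B : X) (f : hom A B) :
  f^‡^‡ \; iso_inv (iota B) = iso_inv (iota A) \; f.
Proof.
rewrite -[RHS](comp_isoK _ (iota B)) -[(_ \; f) \; _]compmA iota_natural.
by rewrite [iso_inv _ \; _]compmA iso_invK comp1m.
Qed.

(** This turns the round trip at a unitary structure into a check on the maps φ_A alone. *)
Lemma unitary_structure_eq (phi psi : unitary_structure X) :
  (forall A, iso_hom (phi A) = iso_hom (psi A)) -> phi = psi.
Proof.
case: phi psi => [u u1 u2] [v v1 v2] /= uv.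
have {}uv : u = v.
  by apply: functional_extensionality_dep => A; apply: iso_eq.
by subst v; f_equal; exact: proof_irrelevance.
Qed.

Lemma inner_product_eq (p q : inner_product X) :
  (forall (A B Y : X) (f : hom A Y) (g : hom B Y), inner p f g = inner q f g) ->
  p = q.
Proof.
case: p q => [p p1 p2 p3 p4 p5] [q q1 q2 q3 q4 q5] /= pq.
have {}pq : p = q by do 5!apply: functional_extensionality_dep => ?.
by subst q; f_equal; exact: proof_irrelevance.
Qed.

End Dagger.

Section InnerOfUnitary.
Variables (X : involutive_category) (phi : unitary_structure X).

Definition unitary_combinator : combinator X :=
  fun A B Y f g => f \; phi Y \; g^‡.

(** Expand ι_A as φ_A φ_{A†} by [U.2]; by [U.1] the second factor is (φ_A⁻¹)†, which cancels φ_A†.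
    This is [IP.2](b) at identities. *)
Lemma iota_unitary_dagger (A : X) : iota A \; (phi A)^‡ = phi A.
Proof.
by rewrite -(unitary_iota phi) -compmA unitary_dagger -daggerM iso_homK dagger1
  compm1.
Qed.

Lemma dual_unitary_combinator (A B Y : X) (h : hom Y A) (k : hom Y B) :
  dual_inner unitary_combinator h k = h^‡ \; iso_inv (phi Y) \; k.
Proof.
(* [U.1] at Y makes the middle factor (φ_Y⁻¹)††, so every factor between ι_{A†} and ι_B⁻¹ is a
   double dagger. Naturality moves ι rightwards and ι⁻¹ leftwards until they meet as ι_Y ι_Y⁻¹. *)
rewrite /dual_inner /unitary_combinator unitary_dagger !daggerM.
rewrite -!compmA iota_inv_natural !compmA -iota_natural.
by rewrite -(compmA _ (iota _)) -iota_natural !compmA comp_isoK.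
Qed.

Lemma unitary_combinator_comp (A B Y V W : X)
    (f : hom A Y) (g : hom B Y) (h : hom V A) (k : hom W B) :
  unitary_combinator (h \; f) (k \; g) = h \; unitary_combinator f g \; k^‡.
Proof. by rewrite /unitary_combinator daggerM !compmA. Qed.

Lemma unitary_combinator_dual (A B Y : X) (f : hom A Y) (g : hom B Y) :
  iota A \; dual_inner unitary_combinator (f^‡) (g^‡) = unitary_combinator f g.
Proof.
(* After f is moved past ι, what remains is ι_Y φ_{Y†}⁻¹, which is φ_Y by [U.2]. *)
rewrite dual_unitary_combinator compmA -iota_natural -(unitary_iota phi).
by rewrite !compmA comp_isoK /unitary_combinator compmA.
Qed.

Lemma unitary_combinator_sym (A B Y : X) (f : hom A Y) (g : hom B Y) :
  iota B \; (unitary_combinator f g)^‡ = unitary_combinator g f.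
Proof.
rewrite /unitary_combinator !daggerM !compmA -iota_natural.
by rewrite -(compmA g) iota_unitary_dagger.
Qed.

Lemma unitary_combinator_mul_dual (A B Y : X)
    (f : hom A Y) (g : hom B Y) (h k : hom Y B) : h \; g = idm Y ->
  unitary_combinator f g \; dual_inner unitary_combinator h k = f \; k.
Proof.
move=> hg; rewrite dual_unitary_combinator /unitary_combinator !compmA.
(* Contravariance gives g† h† = (h g)† = 1, which leaves φ_Y φ_Y⁻¹ between f and k. *)
by rewrite -(compmA _ (g^‡)) -daggerM hg dagger1 compm1 comp_isoK.
Qed.

Lemma unitary_dual_mul_combinator (A Y Z : X)
    (f : hom A Z) (g : hom A Y) (h k : hom Y A) : g \; h = idm A ->
  dual_inner unitary_combinator f g \; unitary_combinator h k = (k \; f)^‡.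
Proof.
move=> gh; rewrite dual_unitary_combinator /unitary_combinator daggerM !compmA.
by rewrite -(compmA _ g) gh compm1 comp_isoVK.
Qed.

Definition inner_of_unitary : inner_product X :=
  InnerProduct unitary_combinator_comp unitary_combinator_dual
    unitary_combinator_sym unitary_combinator_mul_dual
    unitary_dual_mul_combinator.

End InnerOfUnitary.

Section UnitaryOfInner.
Variables (X : involutive_category) (ip : inner_product X).

Lemma inner1_dualK (A : X) :
  inner ip (idm A) (idm A) \; dual_inner ip (idm A) (idm A) = idm A.
Proof. by rewrite inner_mul_dual ?comp1m. Qed.

Lemma dual_inner1K (A : X) :
  dual_inner ip (idm A) (idm A) \; inner ip (idm A) (idm A) = idm (A^†).
Proof. by rewrite dual_mul_inner ?comp1m ?dagger1. Qed.

Definition inner1_iso (A : X) : iso A (A^†) :=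
  Iso (inner1_dualK A) (dual_inner1K A).

Lemma dual_inner1E (A : X) :
  dual_inner ip (idm A) (idm A) = inner1_iso (A^†) \; iso_inv (iota A).
Proof. by rewrite /dual_inner dagger1 compmA inner_sym. Qed.

Lemma inner1_iso_iota (A : X) : inner1_iso A \; inner1_iso (A^†) = iota A.
Proof.
by rewrite -[LHS](comp_isoVK _ (iota A)) -(compmA (inner1_iso A)) -dual_inner1E
  inner1_dualK comp1m.
Qed.

(** Both sides invert φ_A†: the right one on the left, by functoriality, and φ_{A†} on the right, by
    [U.2], already established. *)
Lemma inner1_iso_dagger (A : X) :
  inner1_iso (A^†) = (iso_inv (inner1_iso A))^‡ :> hom (A^†) (A^†^†).
Proof.
symmetry; apply: (@left_inv_eq_right_inv _ _ _ ((inner1_iso A)^‡)).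
  by rewrite -daggerM iso_homK dagger1.
(* This is [IP.2](b) at identities, solved for the dagger. *)
have -> : (inner1_iso A)^‡ = iso_inv (iota A) \; inner1_iso A.
  have {2}<- : iota A \; (inner1_iso A)^‡ = inner1_iso A by exact: inner_sym.
  by rewrite compmA iso_invK comp1m.
by rewrite -compmA inner1_iso_iota iso_invK.
Qed.

Definition unitary_of_inner : unitary_structure X :=
  UnitaryStructure inner1_iso_dagger inner1_iso_iota.

(** [IP.1] applied to f = f 1 and g = g 1; it makes the round trip at a combinator trivial. *)
Lemma inner_via_inner1 (A B Y : X) (f : hom A Y) (g : hom B Y) :
  inner ip f g = f \; inner ip (idm Y) (idm Y) \; g^‡.
Proof. by rewrite -inner_comp !compm1. Qed.

End UnitaryOfInner.

Theorem theorem4p7 (X : involutive_category) :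
  exists (F : unitary_structure X -> inner_product X)
         (G : inner_product X -> unitary_structure X),
    [/\ forall (phi : unitary_structure X) (A B Y : X)
               (f : hom A Y) (g : hom B Y),
          inner (F phi) f g = f \; phi Y \; g^‡,
        forall (ip : inner_product X) (A : X),
          iso_hom (G ip A) = inner ip (idm A) (idm A),
        cancel F G
      & cancel G F].
Proof.
exists (@inner_of_unitary X), (@unitary_of_inner X); split=> //.
- move=> phi; apply: unitary_structure_eq => A /=.
  by rewrite /unitary_combinator dagger1 compm1 comp1m.
- move=> ip; apply: inner_product_eq => A B Y f g.
  by rewrite [RHS]inner_via_inner1.
Qed.
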